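(* Let $g=(g_1,\ldots,g_r)$ and $h=(h_1,\ldots,h_s)$ with $g_i,h_j\in\mathbb{R}[x_1,\ldots,x_n]$, and let $S=\{x\in\mathbb{R}^n: g(x)=0,\ h(x)\le 0\}$. Let $\bar x\in S$ and $u\in T_S(\bar x)$. Suppose that $S$ satisfies algebraic parabolic regularity at $(\bar x,u)$. Then $$T^{2,\mathrm{out}}_S(\bar x;u)=T^{2,\mathrm{in}}_S(\bar x;u)=T^{2,\mathrm{arc}}_S(\bar x;u)=\mathcal{L}^2_S(\bar x;u).$$ In particular, $S$ is parabolically regular at $\bar x$ in direction $u$.
   Context: Bouligand tangent cone: $T_S(\bar x)=\{u\in\mathbb{R}^n:\exists t_k\downarrow 0,\ \exists u_k\to u \text{ with } \bar x+t_ku_k\in S\text{ for all }k\}$ ($t_k\downarrow0$ means $t_k>0$, $t_k\to0$). For $u\in T_S(\bar x)$: - outer parabolic tangent set $T^{2,\mathrm{out}}_S(\bar x;u)$: all $w\in\mathbb{R}^n$ such that there exist $t_k\downarrow0$ and $w_k\to w$ with $\bar x+t_ku+\tfrac12t_k^2w_k\in S$; - inner parabolic tangent set $T^{2,\mathrm{in}}_S(\bar x;u)$: all $w$ such that for every sequence $t_k\downarrow0$ there exist $w_k\to w$ with $\bar x+t_ku+\tfrac12t_k^2w_k\in S$ (membership being required for all sufficiently large $k$); - arc-generated set $T^{2,\mathrm{arc}}_S(\bar x;u)$: all $w$ such that there exist $\varepsilon>0$ and a semialgebraic arc $\gamma:(0,\varepsilon)\to S$ with $\gamma(t)=\bar x+tu+\tfrac12t^2w+o(t^2)$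 as $t\downarrow0$. $S$ is parabolically regular at $\bar x$ in direction $u$ if $T^{2,\mathrm{in}}_S(\bar x;u)=T^{2,\mathrm{out}}_S(\bar x;u)$. Active indices: $I(\bar x)=\{j:h_j(\bar x)=0\}$, $I_0(\bar x;u)=\{j\in I(\bar x):\nabla h_j(\bar x)u=0\}$. $\mathcal{L}^2_S(\bar x;u)$ is the set of $w\in\mathbb{R}^n$ with $Dg(\bar x)w+D^2g(\bar x)[u,u]=0$ and $\nabla h_j(\bar x)w+u^T\nabla^2h_j(\bar x)u\le0$ for all $j\in I_0(\bar x;u)$, where $D^2g(\bar x)[u,u]=(u^T\nabla^2g_i(\bar x)u)_{i=1}^r$. Directional rank stability at $(\bar x,u)$: with the second-order active family $\mathcal{A}_0(\bar x;u)=\{g_1,\ldots,g_r\}\cup\{h_j:j\in I_0(\bar x;u)\}$, there exist a neighborhood $U$ of $\bar x$, a conic neighborhood $V$ of $u$, and an integer $\rho$ such that for every feasible arc $\gamma$ (a continuous curve $\gamma:(0,\varepsilon)\to S$) with $\gamma(t)=\bar x+tv+O(t^2)$, $v\in V$, whose points lie in $U$ and whose first-order active set $\{j\in I(\bar x):\nabla h_j(\bar x)v=0\}$ equals $I_0(\bar x;u)$, the matrix of gradients of the functions in $\mathcal{A}_0(\bar x;u)$ has rank $\rho$ at $\gamma(t)$ for all sufficiently small $t>0$. Parabolic arc-realizability at $(\bar x,u)$: for every $w\in\mathcal{L}^2_S(\bar x;u)$ there exists a semialgebraic arc $\gamma:(0,\varepsilon)\to S$ with $\gamma(t)=\bar x+tu+\tfrac12t^2w+o(t^2)$.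 Algebraic parabolic regularity at $(\bar x,u)$: directional rank stability and parabolic arc-realizability both hold at $(\bar x,u)$. *)

(* Defs.v *)
From mathcomp Require Import all_boot all_order all_algebra.
(* mpoly has to be imported before mathcomp-analysis: in the other order their
   notations clash. *)
From mathcomp Require Import mpoly.
From mathcomp Require Import all_classical all_reals all_analysis.

Set Implicit Arguments.
Unset Strict Implicit.
Unset Printing Implicit Defensive.

Import Order.TTheory GRing.Theory Num.Theory.
Import numFieldNormedType.Exports.

Local Open Scope classical_set_scope.
Local Open Scope ring_scope.

Section Polynomials.
Variables (R : realType) (n : nat).
Implicit Types (p : {mpoly R[n]}) (x : 'cV[R]_n).

Definition peval p x : R := p.@[fun i => x i ord0].

Definition grad p x : 'rV[R]_n := \row_i peval (p^`M(i)) x.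

Definition hess p x : 'M[R]_n :=
  \matrix_(i, j) peval (p^`M(j)^`M(i)) x.

Definition hess_quad p x (u : 'cV[R]_n) : R :=
  (u^T *m hess p x *m u) ord0 ord0.

(* Finite unions of sets defined by finitely many polynomial equations (first
   component) and strict inequalities (second component). *)
Definition semialgebraic (A : set 'cV[R]_n) : Prop :=
  exists L : seq (seq ({mpoly R[n]}) * seq ({mpoly R[n]})),
    A = [set x | has (fun C => all (fun p => peval p x == 0) C.1 &&
                               all (fun p => 0 < peval p x) C.2) L].

End Polynomials.

Section Arcs.
Variables (R : realType) (n : nat).
Implicit Types (S : set 'cV[R]_n) (e : R) (gamma : R -> 'cV[R]_n).

(* Curves (0, e) -> S are total functions whose values outside (0, e) are
   irrelevant. *)
Definition feasible_arc S e gamma : Prop :=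
  [/\ 0 < e, {within `]0, e[, continuous gamma} &
      forall t, t \in `]0, e[ -> S (gamma t)].

(* A curve is semialgebraic when its graph is, as a subset of R^(1+n). *)
Definition semialgebraic_arc S e gamma : Prop :=
  feasible_arc S e gamma /\
  semialgebraic [set col_mx (t%:M : 'M[R]_1) (gamma t) | t in `]0, e[].

End Arcs.

Section Tangents.
Variables (R : realType) (n : nat).
Implicit Types (S : set 'cV[R]_n) (x u w : 'cV[R]_n).

Definition decr0 (t_ : nat -> R) : Prop :=
  (forall k, 0 < t_ k) /\ t_ @ \oo --> (0 : R).

Definition bouligand_cone S x : set 'cV[R]_n :=
  [set u | exists (t_ : nat -> R) (u_ : nat -> 'cV[R]_n),
    [/\ decr0 t_, u_ @ \oo --> u & forall k, S (x + t_ k *: u_ k)]].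

Definition parabola x u w (t : R) : 'cV[R]_n :=
  x + t *: u + (2^-1 * t ^+ 2) *: w.

Definition outer_parabolic S x u : set 'cV[R]_n :=
  [set w | exists (t_ : nat -> R) (w_ : nat -> 'cV[R]_n),
    [/\ decr0 t_, w_ @ \oo --> w & forall k, S (parabola x u (w_ k) (t_ k))]].

Definition inner_parabolic S x u : set 'cV[R]_n :=
  [set w | forall t_ : nat -> R, decr0 t_ ->
    exists w_ : nat -> 'cV[R]_n,
      w_ @ \oo --> w /\ \forall k \near \oo, S (parabola x u (w_ k) (t_ k))].

Definition arc_realizable S x u w : Prop :=
  exists (e : R) (gamma : R -> 'cV[R]_n),
    semialgebraic_arc S e gamma /\
    (fun t => gamma t - parabola x u w t) =o_ (0^'+) (fun t : R => t ^+ 2).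

Definition arc_parabolic S x u : set 'cV[R]_n := [set w | arc_realizable S x u w].

Definition parabolically_regular S x u : Prop :=
  inner_parabolic S x u = outer_parabolic S x u.

Definition conic_nbhs u (V : set 'cV[R]_n) : Prop :=
  nbhs u V /\ forall (c : R) v, 0 < c -> V v -> V (c *: v).

End Tangents.

Section Systems.
Variables (R : realType) (n r s : nat).
Variables (g : 'I_r -> {mpoly R[n]}) (h : 'I_s -> {mpoly R[n]}).
Implicit Types (x y u v w : 'cV[R]_n).

Definition feasible_set : set 'cV[R]_n :=
  [set x | (forall i, peval (g i) x = 0) /\ (forall j, peval (h j) x <= 0)].

Definition active x : {set 'I_s} := [set j | peval (h j) x == 0]%SET.

Definition active0 x u : {set 'I_s} :=
  [set j in active x | grad (h j) x *m u == 0]%SET.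

Definition jacobian_g x : 'M[R]_(r, n) := \matrix_(i < r) grad (g i) x.

Definition D2g x u : 'cV[R]_r := \col_(i < r) hess_quad (g i) x u.

Definition second_order_set x u : set 'cV[R]_n :=
  [set w | jacobian_g x *m w + D2g x u = 0 /\
    forall j, j \in active0 x u ->
      (grad (h j) x *m w) ord0 ord0 + hess_quad (h j) x u <= 0].

(* Gradients at y of the g_i and of the h_j with j in J. *)
Definition family_gradients (J : {set 'I_s}) y : 'M[R]_(r + #|J|, n) :=
  col_mx (jacobian_g y) (\matrix_(k < #|J|) grad (h (enum_val k)) y).

Definition directional_rank_stability x u : Prop :=
  exists (U V : set 'cV[R]_n) (rho : nat),
    [/\ nbhs x U, conic_nbhs u V &
      forall (e : R) (gamma : R -> 'cV[R]_n) v,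
        feasible_arc feasible_set e gamma ->
        (fun t => gamma t - (x + t *: v)) =O_ (0^'+) (fun t : R => t ^+ 2) ->
        V v ->
        (forall t, t \in `]0, e[ -> U (gamma t)) ->
        active0 x v = active0 x u ->
        \forall t \near 0^'+, \rank (family_gradients (active0 x u) (gamma t)) = rho].

Definition parabolic_arc_realizability x u : Prop :=
  forall w, second_order_set x u w -> arc_realizable feasible_set x u w.

Definition algebraic_parabolic_regularity x u : Prop :=
  directional_rank_stability x u /\ parabolic_arc_realizability x u.

End Systems.

(* Main.v *)
Require Import Defs.
From mathcomp Require Import all_boot all_order all_algebra.
From mathcomp Require Import mpoly.
From mathcomp Require Import all_classical all_reals all_analysis.
From mathcomp Require Import ring.

Set Implicit Arguments.
Unset Strict Implicit.
Unset Printing Implicit Defensive.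

Import Order.TTheory GRing.Theory Num.Theory.
Import numFieldNormedType.Exports.

Local Open Scope classical_set_scope.
Local Open Scope ring_scope.

(** The four sets are joined in a circle of inclusions

      arc-generated <= inner <= outer <= second-order set <= arc-generated.

    - An arc with the expansion x + t u + (t^2/2) w + o(t^2) can be sampled
      along any sequence t_k decreasing to 0; solving for w_k in
      gamma(t_k) = x + t_k u + (t_k^2/2) w_k gives w_k --> w
      ([arc_sub_inner]).
    - An inner second-order tangent vector is an outer one: test it on the
      sequence 1/(k+1) ([inner_sub_outer]).
    - Along a parabolic sequence y_k = x + t_k u + (t_k^2/2) w_k with w_k --> w,
      a polynomial p satisfies
        p(y_k) = p(x) + t_k p'(x)u + (t_k^2/2) (p'(x)w + p''(x)[u,u] + o(1))
      ([peval_parabola_expands2]).  For an equality constraint the left-hand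
      side and p(x) vanish; dividing by t_k and letting k grow gives p'(x)u = 0,
      and then dividing by t_k^2 gives the second-order equation.  For an
      inequality constraint active at x with p'(x)u = 0, dividing by t_k^2
      gives the second-order inequality ([outer_sub_second_order]).
    - The last inclusion is parabolic arc-realizability, the second half of
      algebraic parabolic regularity.

    The expansion is proved by structural induction on p: expansions of order
    two add and multiply, and their coefficients do so by the Leibniz rule. *)

(** * Directional derivatives of polynomials *)

Section DirectionalDerivative.
Variables (R : realType) (n : nat).
Implicit Types (p q : {mpoly R[n]}) (x u w : 'cV[R]_n).

(** Kept as a polynomial, rather than as a number at each point, so that it can
    be iterated: the Hessian form at u is then the second iterate, and its
    behaviour on products follows from the Leibniz rule [dirderM]. *)
Definition dirder u p : {mpoly R[n]} := \sum_i u i ord0 *: p^`M(i).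

Lemma dirderD u p q : dirder u (p + q) = dirder u p + dirder u q.
Proof. by rewrite -big_split; apply: eq_bigr => i _; rewrite mderivD scalerDr. Qed.

Lemma dirderM u p q : dirder u (p * q) = dirder u p * q + p * dirder u q.
Proof.
rewrite mulr_suml mulr_sumr -big_split; apply: eq_bigr => i _ /=.
by rewrite mderivM scalerDr scalerAl scalerAr.
Qed.

Lemma dirderC u c : dirder u c%:MP_[n] = 0%:MP.
Proof. by rewrite /dirder mpolyC0 big1 // => i _; rewrite mderivC scaler0. Qed.

Lemma dirderX u i : dirder u 'X_i = (u i ord0)%:MP_[n].
Proof.
rewrite /dirder (bigD1 i) //= big1 ?addr0 => [|j ji]; last first.
  by rewrite mderivX mnm1E eq_sym (negPf ji) scale0r scaler0.
rewrite mderivX mnm1E eqxx scale1r (_ : (U_(i) - U_(i))%MM = 0%MM); last first.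
  by apply/mnmP => j; rewrite mnmBE subnn mnm0E.
by rewrite mpolyX0 -mul_mpolyC mulr1.
Qed.

Lemma grad_dirder p x u : (grad p x *m u) ord0 ord0 = peval (dirder u p) x.
Proof.
rewrite mxE /peval /dirder raddf_sum; apply: eq_bigr => i _ /=.
by rewrite mxE mevalZ mulrC.
Qed.

Lemma hess_quad_dirder p x u : hess_quad p x u = peval (dirder u (dirder u p)) x.
Proof.
rewrite /hess_quad -mulmxA mxE /peval /dirder raddf_sum; apply: eq_bigr => i _ /=.
rewrite !mxE mevalZ (raddf_sum (mderiv i)) raddf_sum; congr (_ * _).
apply: eq_bigr => j _ /=.
by rewrite mxE mderivZ mevalZ mulrC.
Qed.

(** Induction along the ring structure, suited to properties that are stable
    under products; [mpolyind] leaves whole monomials to be treated. *)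
Lemma mpoly_ring_ind (P : {mpoly R[n]} -> Prop) :
  (forall c, P c%:MP_[n]) -> (forall i, P 'X_i) ->
  (forall p q, P p -> P q -> P (p + q)) ->
  (forall p q, P p -> P q -> P (p * q)) ->
  forall p, P p.
Proof.
move=> PC PX PD PM; elim/mpolyind => [|c m p _ _ Pp]; first by rewrite -mpolyC0.
apply: (PD _ _ _ Pp); rewrite -mul_mpolyC; apply: (PM _ _ (PC c)).
rewrite mpolyXE_id; apply: big_ind => [||i _]; rewrite -?mpolyC1 //.
by elim: (m i) => [|k IHk]; rewrite ?expr0 -?mpolyC1 // exprS; apply: PM.
Qed.

End DirectionalDerivative.

(** * Second-order expansions along a sequence *)

Section SecondOrderExpansion.
Variables (R : realType) (t_ : nat -> R).

(** The remainder o(t_k^2) is absorbed in a convergent coefficient c_k, which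
    makes the expansion an exact identity and products a ring computation. *)
Definition expands2 (f : nat -> R) (a b c : R) : Prop :=
  exists c_ : nat -> R, c_ @ \oo --> c /\
    forall k, f k = a + t_ k * b + t_ k ^+ 2 * c_ k.

Lemma expands2_cst a : expands2 (fun=> a) a 0 0.
Proof. by exists (fun=> 0); split=> [|k]; [exact: cvg_cst | ring]. Qed.

Lemma expands2D f1 a1 b1 c1 f2 a2 b2 c2 :
  expands2 f1 a1 b1 c1 -> expands2 f2 a2 b2 c2 ->
  expands2 (fun k => f1 k + f2 k) (a1 + a2) (b1 + b2) (c1 + c2).
Proof.
move=> [d1 [d1c E1]] [d2 [d2c E2]]; exists (fun k => d1 k + d2 k).
by split=> [|k]; [exact: cvgD | rewrite E1 E2; ring].
Qed.

Hypothesis t0 : t_ @ \oo --> (0 : R).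

Lemma expands2M f1 a1 b1 c1 f2 a2 b2 c2 :
  expands2 f1 a1 b1 c1 -> expands2 f2 a2 b2 c2 ->
  expands2 (fun k => f1 k * f2 k) (a1 * a2) (b1 * a2 + a1 * b2)
    (c1 * a2 + b1 * b2 + a1 * c2).
Proof.
move=> [d1 [d1c E1]] [d2 [d2c E2]].
(* The second line collects the terms of order 3 and 4 in t_k, which are
   divided by t_k ^+ 2 and so still vanish in the limit. *)
exists (fun k => d1 k * a2 + b1 * b2 + a1 * d2 k
  + t_ k * (d1 k * b2 + b1 * d2 k + t_ k * (d1 k * d2 k))).
split=> [|k]; last by rewrite E1 E2; ring.
rewrite -[X in _ --> X]addr0 -[X in _ + X](mul0r (c1 * b2 + b1 * c2 + 0 * (c1 * c2))).
apply: cvgD.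
  by apply: cvgD; [apply: cvgD; [exact: cvgMl|exact: cvg_cst]|exact: cvgMr].
apply: cvgM => //; apply: cvgD; last by apply: cvgM => //; exact: cvgM.
by apply: cvgD; [exact: cvgMl|exact: cvgMr].
Qed.

Lemma expands2_order1 f b c : (forall k, 0 < t_ k) ->
  expands2 f 0 b c -> (fun k => f k / t_ k) @ \oo --> b.
Proof.
move=> tp [c_ [cc E]].
have -> : (fun k => f k / t_ k) = (fun k => b + t_ k * c_ k).
  by apply/funext => k; rewrite E; have := tp k => ?; field; rewrite gt_eqF.
rewrite -[X in _ --> X]addr0 -[X in _ + X](mul0r c).
by apply: cvgD; [exact: cvg_cst | exact: cvgM].
Qed.

Lemma expands2_order2 f c : (forall k, 0 < t_ k) ->
  expands2 f 0 0 c -> (fun k => f k / t_ k ^+ 2) @ \oo --> c.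
Proof.
move=> tp [c_ [cc E]].
have -> // : (fun k => f k / t_ k ^+ 2) = c_.
by apply/funext => k; rewrite E; have := tp k => ?; field; rewrite gt_eqF.
Qed.

(** The second-order chain rule along a parabolic sequence.  The points
    [w_ k] may vary with k: they enter only at order two, where their limit is
    all that counts. *)
Lemma peval_parabola_expands2 n (p : {mpoly R[n]}) (x u w : 'cV[R]_n) w_ :
  w_ @ \oo --> w ->
  expands2 (fun k => peval p (parabola x u (w_ k) (t_ k)))
    (peval p x) ((grad p x *m u) ord0 ord0)
    (2^-1 * ((grad p x *m w) ord0 ord0 + hess_quad p x u)).
Proof.
move=> wc; rewrite !grad_dirder hess_quad_dirder.
elim/mpoly_ring_ind: p => [c|i|p q IHp IHq|p q IHp IHq].
- have -> : (fun k => peval c%:MP_[n] (parabola x u (w_ k) (t_ k))) = (fun=> c).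
    by apply/funext => k; rewrite /peval mevalC.
  by rewrite !dirderC /peval !mevalC addr0 mulr0; exact: expands2_cst.
- rewrite !dirderX dirderC /peval !mevalC mevalXU addr0.
  exists (fun k => 2^-1 * w_ k i ord0); split=> [|k].
    apply: cvgMr.
    exact: (cvg_comp _ _ wc (@coord_continuous _ _ _ i ord0 w)).
  by rewrite mevalXU !mxE; ring.
- have -> : (fun k => peval (p + q) (parabola x u (w_ k) (t_ k))) =
      (fun k => peval p (parabola x u (w_ k) (t_ k)) +
                peval q (parabola x u (w_ k) (t_ k))).
    by apply/funext => k; rewrite /peval mevalD.
  have := expands2D IHp IHq; rewrite !dirderD /peval !mevalD.
  by congr expands2; ring.
have -> : (fun k => peval (p * q) (parabola x u (w_ k) (t_ k))) =
    (fun k => peval p (parabola x u (w_ k) (t_ k)) *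
              peval q (parabola x u (w_ k) (t_ k))).
  by apply/funext => k; rewrite /peval mevalM.
have := expands2M IHp IHq; rewrite !(dirderM, dirderD) /peval !(mevalM, mevalD).
by congr expands2; field.
Qed.

End SecondOrderExpansion.

(** * Inclusions between the second-order tangent sets *)

Section TangentSets.
Variables (R : realType) (n : nat) (S : set 'cV[R]_n) (x u : 'cV[R]_n).

(** The choice of [w_ k] is forced by the requirement that the parabola
    meet the arc at [t_ k]; the error [w_ k - w] is then twice the o(t^2)
    remainder divided by t^2. *)
Lemma arc_sub_inner : arc_parabolic S x u `<=` inner_parabolic S x u.
Proof.
move=> w [e [gam [[[e0 _ Sg] _] /eqoP o_]]] t_ [tp tc].
have tr : t_ @ \oo --> 0^'+.
  move=> A A0.
  have : \forall k \near \oo, 0 < t_ k -> A (t_ k).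
    exact: (tc [set y | 0 < y -> A y] A0).
  by apply: filterS => k; apply.
pose w_ k := (2 * t_ k ^- 2) *: (gam (t_ k) - (x + t_ k *: u)).
have w_E k : parabola x u (w_ k) (t_ k) = gam (t_ k).
  rewrite /parabola scalerA (_ : _ * _ * _ = 1) ?scale1r ?subrKC //.
  by have := tp k => ?; field; rewrite gt_eqF.
exists w_; split; last first.
  have : \forall k \near \oo, t_ k < e by exact: (cvgr_lt _ tc).
  by apply: filterS => k te; rewrite w_E; apply: Sg; rewrite in_itv /= tp.
apply/cvgrPdist_le => eps eps0.
have : \forall k \near \oo,
    `|gam (t_ k) - parabola x u w (t_ k)| <= eps / 2 * `|t_ k ^+ 2|.
  have e2 : 0 < eps / 2 by rewrite divr_gt0.
  exact: (tr _ (o_ _ e2)).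
apply: filterS => k.
have t2 : 0 < t_ k ^+ 2 by rewrite exprn_gt0.
rewrite -w_E /parabola opprD addrACA subrr add0r -scalerBr normrZ distrC.
rewrite normrM !gtr0_norm ?invr_gt0 //.
by rewrite mulrC mulrA !ler_pM2r // invr_gt0.
Qed.

Lemma inner_sub_outer : inner_parabolic S x u `<=` outer_parabolic S x u.
Proof.
move=> w inn.
have [|w_ [wc [N _ SN]]] := inn (@harmonic R).
  by split=> [k|]; [exact: harmonic_gt0 | exact: cvg_harmonic].
(* Inner tangency gives membership only from rank N on, whereas outer tangency
   asks for it at every rank: drop the first N terms. *)
exists (fun k => harmonic (k + N)%N), (fun k => w_ (k + N)%N); split.
- split=> [k|]; first exact: harmonic_gt0.
  by rewrite (cvg_shiftn N (@harmonic R)); exact: cvg_harmonic.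
- by rewrite (cvg_shiftn N w_).
- by move=> k; apply: SN; rewrite /= leq_addl.
Qed.

End TangentSets.

(** The constraints hold along the parabolic sequence, so the leading
    coefficients of their expansions inherit the equations and the sign
    conditions.  For the equalities the first-order coefficient has to be shown
    to vanish before the second-order one can be read off; for the inequalities
    it vanishes by the definition of [active0]. *)
Lemma outer_sub_second_order (R : realType) (n r s : nat)
    (g : 'I_r -> {mpoly R[n]}) (h : 'I_s -> {mpoly R[n]}) (x u : 'cV[R]_n) :
  feasible_set g h x ->
  outer_parabolic (feasible_set g h) x u `<=` second_order_set g h x u.
Proof.
move=> [gx hx] w [t_ [w_ [[tp tc] wc Sk]]]; split.
- apply/colP => i; rewrite !mxE /=.
  have := peval_parabola_expands2 tc (g i) x u wc.
  rewrite (_ : (fun _ => _) = fun=> 0); last by apply/funext => k; apply: (Sk k).1.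
  rewrite gx => E.
  have cvg0 (d : nat -> R) l : (fun k => 0 / d k) @ \oo --> l -> l = 0.
    rewrite (_ : (fun _ => _) = fun=> 0); last by apply/funext => k; rewrite mul0r.
    by move=> /cvg_lim <- //; exact: lim_cst.
  move: (E); rewrite (cvg0 _ _ (expands2_order1 tc tp E)) => E0.
  have /eqP := cvg0 _ _ (expands2_order2 tp E0).
  rewrite mulf_eq0 invr_eq0 pnatr_eq0 /= => /eqP Ew.
  by rewrite -[RHS]Ew mxE; congr (_ + _); apply: eq_bigr => j _; rewrite !mxE.
move=> j; rewrite !inE => /andP[/eqP hj0 /eqP gu].
have := peval_parabola_expands2 tc (h j) x u wc.
rewrite hj0 gu mxE => E.
have L := expands2_order2 tp E.
have : 2^-1 * ((grad (h j) x *m w) ord0 ord0 + hess_quad (h j) x u) <= 0.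
  rewrite -(cvg_lim _ L) //; apply: limr_le; first by apply/cvg_ex; eexists; exact: L.
  apply: nearW => k; apply: mulr_le0_ge0; first by apply: (Sk k).2.
  by rewrite invr_ge0 exprn_ge0 // ltW.
by rewrite pmulr_rle0 // invr_gt0.
Qed.

Theorem theorem3p2 (R : realType) (n r s : nat)
    (g : 'I_r -> {mpoly R[n]}) (h : 'I_s -> {mpoly R[n]})
    (x u : 'cV[R]_n) :
  let S := feasible_set g h in
  S x -> bouligand_cone S x u ->
  algebraic_parabolic_regularity g h x u ->
  [/\ outer_parabolic S x u = inner_parabolic S x u,
      inner_parabolic S x u = arc_parabolic S x u,
      arc_parabolic S x u = second_order_set g h x u &
      parabolically_regular S x u].
Proof.
move=> S Sx _ [_ realizable].
have arc_in : arc_parabolic S x u `<=` inner_parabolic S x u by exact: arc_sub_inner.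
have in_out : inner_parabolic S x u `<=` outer_parabolic S x u by exact: inner_sub_outer.
have out_L2 : outer_parabolic S x u `<=` second_order_set g h x u.
  exact: outer_sub_second_order.
have L2_arc : second_order_set g h x u `<=` arc_parabolic S x u by exact: realizable.
have in_eq_out : inner_parabolic S x u = outer_parabolic S x u.
  by apply/seteqP; split=> // w /out_L2/L2_arc/arc_in.
split=> //; apply/seteqP; split=> // w.
- by move=> /in_out/out_L2/L2_arc.
- by move=> /arc_in/in_out/out_L2.
Qed.
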